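(* Any $\sigma(\mathcal{P},C_b)$-lower semicontinuous risk measure $\Phi:\mathcal{P}(\mathbb{R})\to\mathbb{R}\cup\{+\infty\}$ can be represented as $$\Phi(P)=\sup_{f\in C_b^-}R\left(\int f\,dP,f\right)=\sup_{f\in C_b^-}R^-\left(\int f\,dP,f\right),\qquad P\in\mathcal{P}(\mathbb{R}),$$ where $R(t,f):=\inf_{Q\in\mathcal{P}}\{\Phi(Q)\mid\int f\,dQ\ge t\}$ and $R^-(t,f):=\sup\{R(s,f)\mid s<t\}$ for $(t,f)\in\mathbb{R}\times C_b$. Moreover, the function $R^-$ can be written as $$R^-(t,f)=\inf\{m\in\mathbb{R}\mid\gamma(m,f)\ge t\},$$ where $\gamma:\mathbb{R}\times C_b\to\overline{\mathbb{R}}$ is given by $$\gamma(m,f):=\sup_{Q\in\mathcal{P}}\left\{\int f\,dQ\ \Big|\ \Phi(Q)\le m\right\},\qquad m\in\mathbb{R}.$$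
   Context: $\mathcal{P}=\mathcal{P}(\mathbb{R})$ is the set of Borel probability measures on $\mathbb{R}$, $F_P(x)=P(-\infty,x]$, and $Q\preccurlyeq P$ iff $F_P(x)\le F_Q(x)$ for all $x\in\mathbb{R}$. $C_b$ is the space of bounded continuous functions $f:\mathbb{R}\to\mathbb{R}$ and $C_b^-=\{f\in C_b\mid f\text{ is decreasing}\}$ (decreasing in the weak sense); $\sigma(\mathcal{P},C_b)$ is the topology of weak convergence. A risk measure on $\mathcal{P}(\mathbb{R})$ is a map $\Phi:\mathcal{P}\to\mathbb{R}\cup\{+\infty\}$ that is monotone decreasing ($P\preccurlyeq Q$ implies $\Phi(P)\ge\Phi(Q)$) and quasi-convex ($\Phi(\lambda P+(1-\lambda)Q)\le\Phi(P)\vee\Phi(Q)$ for $\lambda\in[0,1]$). Conventions: $\inf\emptyset=+\infty$, $\sup\emptyset=-\infty$. *)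

(* Defs.v *)
From HB Require Import structures.
From mathcomp Require Import all_boot all_order all_algebra.
From mathcomp Require Import all_classical all_reals all_analysis.

Set Implicit Arguments.
Unset Strict Implicit.
Unset Printing Implicit Defensive.

Import Order.TTheory GRing.Theory Num.Theory.
Import numFieldNormedType.Exports.

Local Open Scope classical_set_scope.
Local Open Scope ring_scope.

(* A library measure is a function on all sets, so two elements of [borelP R]
   may represent the same Borel measure and differ on non-Borel sets. Every
   notion below depends only on the values on Borel sets; in particular a
   monotone [Phi] takes the same value on two such elements, because they have
   the same distribution function. *)
Definition borelP (R : realType) : Type := probability (measurableTypeR R) R.

HB.instance Definition _ (R : realType) := Choice.on (borelP R).
HB.instance Definition _ (R : realType) := Pointed.on (borelP R).

Definition Cb (R : realType) : set (R -> R) :=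
  [set f | continuous f /\ bounded_fun f].

Definition Cb_decr (R : realType) : set (R -> R) :=
  [set f | Cb f /\ nonincreasing_fun f].

(* sigma(P, C_b): the coarsest topology making P |-> \int f dP continuous
   for every f in C_b. *)
HB.instance Definition _ (R : realType) :=
  Topological.copy (borelP R)
    (sup_topology (fun f : {f : R -> R | Cb f} =>
       Topological.class (initial_topology
         (fun P : borelP R => \int[P]_x (sval f x))))).

Definition distrib_fun (R : realType) (P : borelP R) (x : R) : \bar R :=
  P (`]-oo, x]%classic).

Definition fosd (R : realType) (Q P : borelP R) : Prop :=
  forall x, (distrib_fun P x <= distrib_fun Q x)%E.

Section mixture.
Context (R : realType) (l : {i01 R}) (P Q : borelP R).

Definition mixture : set (measurableTypeR R) -> \bar R :=
  measure_add (mscale l%:num%:nng P) (mscale (1 - l%:num)%:nng Q).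

HB.instance Definition _ := Measure.on mixture.

Lemma mixtureE A :
  mixture A = (l%:num%:E * P A + (1 - l%:num)%:E * Q A)%E.
Proof. by rewrite /mixture measure_addE. Qed.

Let mixture_setT : mixture setT = 1%E.
Proof. by rewrite mixtureE !probability_setT !mule1 -EFinD addrC subrK. Qed.

HB.instance Definition _ := Measure_isProbability.Build _ _ _
  mixture mixture_setT.

End mixture.

Record risk_measure (R : realType) (Phi : borelP R -> \bar R) : Prop := {
  risk_gtNy : forall P, (-oo < Phi P)%E ;
  risk_monotone : forall P Q, fosd P Q -> (Phi Q <= Phi P)%E ;
  risk_quasiconvex : forall (l : {i01 R}) P Q,
    (Phi (mixture l P Q) <= maxe (Phi P) (Phi Q))%E }.

(* [dualR], [dualR_left] and [support_level] are R, R^- and gamma of the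
   quasi-convex duality. The library has inf set0 = +oo and sup set0 = -oo in
   the extended reals, as the formulas require. *)
Definition dualR (R : realType) (Phi : borelP R -> \bar R) (t : R)
    (f : R -> R) : \bar R :=
  ereal_inf [set Phi Q | Q in [set Q : borelP R | t <= \int[Q]_x f x]].

Definition dualR_left (R : realType) (Phi : borelP R -> \bar R) (t : R)
    (f : R -> R) : \bar R :=
  ereal_sup [set dualR Phi s f | s in [set s | s < t]].

Definition support_level (R : realType) (Phi : borelP R -> \bar R) (m : R)
    (f : R -> R) : \bar R :=
  ereal_sup [set (\int[Q]_x f x)%:E | Q in [set Q : borelP R | (Phi Q <= m%:E)%E]].

(* Main.v *)
Require Import Defs.
From HB Require Import structures.
From mathcomp Require Import all_boot all_order all_algebra.
From mathcomp Require Import all_classical all_reals all_analysis.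
From mathcomp Require Import measurable_realfun ring lra.

(** The sublevel sets [A] of [Phi] are convex, weakly closed and closed under
    passing to a stochastically larger measure. If [a < Phi P], a weak
    neighbourhood of [P] missing [A = {Phi <= a}] is determined by finitely many
    [f_i] in [Cb], so that [A] and [P] are separated after mapping [Q] to the
    bounded convex subset of vectors [(\int f_i dQ)_i] of a Euclidean space: an
    almost norm-minimal point there yields [f] in [Cb] with
    [sup_A \int f dQ < \int f dP]. Such an [f] may be replaced by its decreasing
    envelope [g x = sup_(y >= x) f y]: this only increases the integral against
    [P], and leaves the supremum over [A] unchanged, because any [Q] can be
    pushed forward by a nondecreasing map [T x >= x] with [g x - h <= f (T x)].
    Separation by a decreasing function gives both dual representations; the
    formula for [R^-] is a manipulation of suprema and infima. *)

Set Implicit Arguments.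
Unset Strict Implicit.
Unset Printing Implicit Defensive.

Import Order.TTheory GRing.Theory Num.Theory.
Import numFieldNormedType.Exports.

Local Open Scope classical_set_scope.
Local Open Scope ring_scope.

(** * Bounded continuous functions and their integrals *)

Section Cb_theory.
Context {R : realType}.
Implicit Types (P Q : borelP R) (f g : R -> R) (l : seq {f : R -> R | Cb f}).

Lemma Cb_bound f : Cb f -> exists M, forall x, `|f x| <= M.
Proof.
(* [bounded_fun] grants the bound only for numbers strictly above [M]. *)
move=> [_ [M [_ Mf]]]; exists (M + 1) => x.
by apply: Mf => //; rewrite ltrDl.
Qed.

Lemma bound_Cb f M : continuous f -> (forall x, `|f x| <= M) -> Cb f.
Proof.
move=> cf fM; split=> //; exists M; split; first exact: num_real.
by move=> N MN x _; apply: le_trans (fM x) (ltW MN).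
Qed.

Lemma Cb_cst c : Cb (fun=> c : R).
Proof. by apply: (@bound_Cb _ `|c|) => // x; exact: cvg_cst. Qed.

Lemma CbD f g : Cb f -> Cb g -> Cb (fun x => f x + g x).
Proof.
move=> fC gC; have [M fM] := Cb_bound fC; have [N gN] := Cb_bound gC.
apply: (@bound_Cb _ (M + N)) => x.
  by apply: continuousD; [exact: fC.1 | exact: gC.1].
by rewrite (le_trans (ler_normD _ _))// lerD.
Qed.

Lemma CbZ c f : Cb f -> Cb (fun x => c * f x).
Proof.
move=> fC; have [M fM] := Cb_bound fC.
apply: (@bound_Cb _ (`|c| * M)) => x.
  by apply: continuousM; [exact: cvg_cst | exact: fC.1].
by rewrite normrM ler_wpM2l.
Qed.

Lemma Cb_measurable f : Cb f -> measurable_fun setT f.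
Proof. by move=> fC; apply: continuous_measurable_fun; exact: fC.1. Qed.

Lemma bounded_integrable P f M : measurable_fun setT f ->
  (forall x, `|f x| <= M) -> P.-integrable setT (EFin \o f).
Proof.
move=> mf fM; apply: measurable_bounded_integrable => //.
  by rewrite [ltLHS]probability_setT ltry.
exists M; split; first exact: num_real.
by move=> N MN x _; apply: le_trans (fM x) (ltW MN).
Qed.

Lemma Cb_integrable P f : Cb f -> P.-integrable setT (EFin \o f).
Proof.
move=> fC; have [M fM] := Cb_bound fC.
exact: bounded_integrable (Cb_measurable fC) fM.
Qed.

Lemma probability_Rintegral_cst P (c : R) : \int[P]_x c = c.
Proof.
rewrite Rintegral_cst//.
exact: etrans (congr1 (fun z => c * fine z) (probability_setT P)) (mulr1 c).
Qed.

Lemma normr_Rintegral_le P f M : Cb f -> (forall x, `|f x| <= M) ->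
  `|\int[P]_x f x| <= M.
Proof.
move=> fC fM; have fi := Cb_integrable P fC.
rewrite ler_norml -(probability_Rintegral_cst P M).
rewrite -[- _]mulN1r -RintegralZl//; last exact: Cb_integrable (Cb_cst M).
apply/andP; split; apply: le_Rintegral => //;
  try (exact: Cb_integrable (Cb_cst _)).
- by move=> x _; rewrite mulN1r; have := fM x; rewrite ler_norml => /andP[].
- by move=> x _; have := fM x; rewrite ler_norml => /andP[].
Qed.

(** For nonnegative integrands this is additivity of the integral in the measure. A general [f] is
    shifted up by a bound [M]; the weights sum to one, so [M] cancels. *)
Lemma Rintegral_mixture (r : {i01 R}) P Q f : Cb f ->
  \int[mixture r P Q]_x f x =
  r%:num * \int[P]_x f x + (1 - r%:num) * \int[Q]_x f x.
Proof.
have nneg g : Cb g -> (forall x, 0 <= g x) -> \int[mixture r P Q]_x g x =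
    r%:num * \int[P]_x g x + (1 - r%:num) * \int[Q]_x g x.
  move=> gC g0; have /measurable_EFinP mg := Cb_measurable gC.
  have ge0 x : setT x -> (0 <= (EFin \o g) x)%E by rewrite lee_fin.
  have mixE : (\int[mixture r P Q]_x (g x)%:E =
      r%:num%:E * \int[P]_x (g x)%:E + (1 - r%:num)%:E * \int[Q]_x (g x)%:E)%E.
    apply: etrans (ge0_integral_measure_add (mscale r%:num%:nng P)
      (mscale (1 - r%:num)%:nng Q) measurableT ge0 mg) _.
    by congr (_ + _)%E; exact: ge0_integral_mscale.
  rewrite /Rintegral mixE.
  have fP := integrable_fin_num measurableT (Cb_integrable P gC).
  have fQ := integrable_fin_num measurableT (Cb_integrable Q gC).
  rewrite fineD ?fin_numM//.
  by rewrite !fineM.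
move=> fC; have [M fM] := Cb_bound fC.
have gC : Cb (fun x => f x + M) by exact: CbD fC (Cb_cst M).
have g0 x : 0 <= f x + M.
  by have := fM x; rewrite ler_norml => /andP[? _]; rewrite -lerBlDr sub0r.
have shift (S : borelP R) : \int[S]_x (f x + M) = \int[S]_x f x + M.
  rewrite RintegralD//; [|exact: Cb_integrable|exact: Cb_integrable (Cb_cst _)].
  by rewrite probability_Rintegral_cst.
have := nneg _ gC g0; rewrite !shift => /eqP.
rewrite -subr_eq0 => /eqP h; apply/eqP; rewrite -subr_eq0; apply/eqP.
by rewrite -{}h; ring.
Qed.

(** * Weak neighbourhoods and separation from a convex set *)

Lemma Cb_sum l (c : {f : R -> R | Cb f} -> R) :
  Cb (fun x => \sum_(f <- l) c f * sval f x).
Proof.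
elim: l => [|f l IH].
  rewrite [X in Cb X](_ : _ = fun=> 0); first exact: Cb_cst.
  by apply/funext => x; rewrite big_nil.
rewrite [X in Cb X](_ : _ =
    fun x => c f * sval f x + \sum_(g <- l) c g * sval g x).
  by apply: CbD IH; exact: CbZ (svalP f).
by apply/funext => x; rewrite big_cons.
Qed.

Lemma Rintegral_sum P l (c : {f : R -> R | Cb f} -> R) :
  \int[P]_x (\sum_(f <- l) c f * sval f x) =
  \sum_(f <- l) c f * \int[P]_x sval f x.
Proof.
elim: l => [|f l IH].
  rewrite big_nil -[RHS](probability_Rintegral_cst P).
  by apply: eq_Rintegral => x _; rewrite big_nil.
rewrite big_cons -IH -RintegralZl//; last exact: Cb_integrable (svalP f).
rewrite -RintegralD//.
- by apply: eq_Rintegral => x _; rewrite big_cons.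
- exact: Cb_integrable (CbZ _ (svalP f)).
- exact: Cb_integrable (Cb_sum _ _).
Qed.

(** The bound is uniform in both measures; it controls the quadratic term of a small convex step. *)
Lemma Rintegral_sqdist_bound l :
  exists2 D : R, 0 <= D & forall P Q,
    \sum_(f <- l) (\int[P]_x sval f x - \int[Q]_x sval f x) ^+ 2 <= D.
Proof.
elim: l => [|f l [D D0 lD]]; first by exists 0 => // P Q; rewrite big_nil.
have [M fM] := Cb_bound (svalP f); exists ((M + M) ^+ 2 + D).
  by rewrite addr_ge0// sqr_ge0.
move=> P Q; rewrite big_cons lerD// -[leLHS]real_normK ?num_real//.
have fPQ : `|\int[P]_x sval f x - \int[Q]_x sval f x| <= M + M.
  rewrite (le_trans (ler_normB _ _))// lerD//;
  exact: normr_Rintegral_le (svalP f) fM.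
by rewrite lerXn2r// nnegrE// (le_trans _ fPQ).
Qed.

(** The sets [V] with this property form a filter [F]. Convergence in a supremum topology is tested
    on each generating initial topology, which gives [F --> P]: every neighbourhood of [P] is in
    [F]. *)
Lemma nbhs_borelP P (V : set (borelP R)) : nbhs P V ->
  exists l, exists2 e : R, 0 < e & forall Q,
    \sum_(f <- l) (\int[Q]_x sval f x - \int[P]_x sval f x) ^+ 2 < e -> V Q.
Proof.
pose F : set_system (borelP R) := [set V |
  exists l, exists2 e : R, 0 < e & forall Q,
    \sum_(f <- l) (\int[Q]_x sval f x - \int[P]_x sval f x) ^+ 2 < e -> V Q].
have sum_ge0 l Q :
    0 <= \sum_(f <- l) (\int[Q]_x sval f x - \int[P]_x sval f x) ^+ 2.
  by apply: sumr_ge0 => f _; exact: sqr_ge0.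
have FF : Filter F.
  split.
  - by exists [::], 1.
  - move=> A B [l [e e0 lA]] [m [d d0 mB]].
    exists (l ++ m), (Num.min e d); first by rewrite lt_min e0.
    move=> Q; rewrite big_cat/= lt_min => /andP[Qe Qd]; split.
      by apply: lA; apply: le_lt_trans Qe; rewrite lerDl.
    by apply: mB; apply: le_lt_trans Qd; rewrite lerDr.
  - move=> A B AB [l [e e0 lA]]; exists l, e => // Q /lA; exact: AB.
suff : F --> P by apply.
apply/(@cvg_sup _ _ (fun f : {f : R -> R | Cb f} =>
   Topological.class (initial_topology
     (fun P : borelP R => \int[P]_x (sval f x)))) F P) => f.
move=> A; rewrite nbhsE => -[B [[U openU <-] UP] BA].
have /nbhs_ballP[e /= e0 eU] : nbhs (\int[P]_x sval f x) U.
  exact: open_nbhs_nbhs.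
(* The radius is squared because [F] measures squared distances. *)
exists [:: f], (e ^+ 2); first exact: exprn_gt0.
move=> Q; rewrite big_seq1 => Qe; apply/BA/eU.
rewrite /ball/= distrC -(@ltr_pXn2r _ 2)// ?nnegrE// ?ltW//.
by rewrite real_normK ?num_real.
Qed.

(* [n = |x|^2] is almost the minimum [d] of the squared norm on a convex set,
   [S = <x, y>] and [W = |y - x|^2]: moving from [x] towards [y] by the small
   step [s] cannot beat [d], which bounds [<x, y>] from below. *)
Lemma near_min_inner (s e D d n S W : R) : 0 < s -> s * D <= e / 2 ->
  n < d + s * (e / 2) -> d <= n + 2 * s * (S - n) + s ^+ 2 * W ->
  W <= D -> e <= n -> e / 2 <= S.
Proof.
move=> s0 sD nd dW WD en.
have : 0 <= s * (e / 2 + 2 * (S - n) + s * W) by lra.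
rewrite pmulr_rge0// => h.
have : s * W <= s * D by rewrite ler_pM2l.
lra.
Qed.

(** With [P] at the origin, the vectors [u Q] for [Q] in [A] have squared norm at least [e]. An
    almost norm-minimal [u Q0] then has inner product at least [e / 2] with all of them. *)
Lemma convex_separation P (A : set (borelP R)) (V : set (borelP R)) :
  (forall (r : {i01 R}) Q Q', A Q -> A Q' -> A (mixture r Q Q')) ->
  nbhs P V -> V `&` A = set0 ->
  exists2 f, Cb f & exists2 d : R, 0 < d &
    forall Q, A Q -> \int[Q]_x f x + d <= \int[P]_x f x.
Proof.
move=> cvxA /nbhs_borelP[l [e e0 lV]] VA0.
have [A0|/set0P[Q1 AQ1]] := eqVneq A set0.
  exists (fun=> 0); first exact: Cb_cst.
  by exists 1 => // Q; rewrite A0.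
pose u Q (f : {f : R -> R | Cb f}) := \int[Q]_x sval f x - \int[P]_x sval f x.
pose N Q := \sum_(f <- l) u Q f ^+ 2.
have NeA Q : A Q -> e <= N Q.
  move=> AQ; rewrite leNgt; apply/negP => /lV VQ.
  by have : (V `&` A) Q by []; rewrite VA0.
have [D D0 lD] := Rintegral_sqdist_bound l.
pose d := inf [set N Q | Q in A].
have lbA : has_lbound [set N Q | Q in A] by exists e => _ [Q AQ <-]; exact: NeA.
have infA : has_inf [set N Q | Q in A] by split=> //; exists (N Q1); exists Q1.
have dN Q : A Q -> d <= N Q by move=> AQ; apply: ge_inf => //; exists Q.
(* Small enough for [s * D <= e / 2]; the summand [e] ensures a positive denominator and
   [s <= 1]. *)
pose s : R := e / (2 * (D + e)).
have De : 0 < 2 * (D + e) by rewrite mulr_gt0// ltr_wpDl.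
have s0 : 0 < s by rewrite divr_gt0.
have s1 : s <= 1 by rewrite ler_pdivrMr// mul1r; lra.
have sD : s * D <= e / 2.
  rewrite /s mulrAC ler_pdivrMr// [leRHS](_ : _ = e * D + e * e); last by field.
  by rewrite lerDl mulr_ge0// ltW.
pose r : {i01 R} := Itv01 (ltW s0) s1.
have [_ [Q0 AQ0 <-] NQ0] :=
  inf_adherent (mulr_gt0 s0 (divr_gt0 e0 (ltr0n R 2))) infA.
rewrite -/d in NQ0.
(* The vector [u Q0] points from [P] towards [A]; the minus sign gives [P] the larger integral. *)
exists (fun x => \sum_(f <- l) - u Q0 f * sval f x); first exact: Cb_sum.
exists (e / 2); first by rewrite divr_gt0.
move=> Q AQ; rewrite !Rintegral_sum.
have dmix := dN _ (cvxA r Q Q0 AQ AQ0).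
(* Expansion of [|x + s (y - x)|^2] with [x = u Q0] and [y = u Q]. *)
have mixE : N (mixture r Q Q0) =
    N Q0 + 2 * s * (\sum_(f <- l) u Q0 f * u Q f - N Q0) +
    s ^+ 2 * \sum_(f <- l) (\int[Q]_x sval f x - \int[Q0]_x sval f x) ^+ 2.
  rewrite /N -sumrB !mulr_sumr -!big_split/=; apply: eq_bigr => f _.
  by rewrite /u (Rintegral_mixture _ _ _ (svalP f))/=; ring.
have prodE : \sum_(f <- l) u Q0 f * u Q f =
    \sum_(f <- l) - u Q0 f * \int[P]_x sval f x -
    \sum_(f <- l) - u Q0 f * \int[Q]_x sval f x.
  rewrite -sumrB; apply: eq_bigr => f _.
  by rewrite /u; ring.
suff : e / 2 <= \sum_(f <- l) u Q0 f * u Q f by rewrite prodE lerBrDl.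
rewrite mixE in dmix.
exact: near_min_inner s0 sD NQ0 dmix (lD Q Q0) (NeA _ AQ0).
Qed.

(** * The decreasing envelope and the monotone shift realising it up to [h] *)

Definition decr_env f (x : R) : R := sup [set f y | y in [set y | x <= y]].

(** For [f] in [Cb] and [h > 0] the set is nonempty and closed, so the infimum is attained. Choosing
    the leftmost point makes the map monotone, hence measurable. *)
Definition env_shift f (h : R) (x : R) : R :=
  inf [set y | x <= y /\ decr_env f x - h <= f y].

Lemma decr_env_has_sup f x : Cb f -> has_sup [set f y | y in [set y | x <= y]].
Proof.
move=> fC; have [M fM] := Cb_bound fC; split; first by exists (f x), x => /=.
by exists M => _ [y _ <-]; rewrite (le_trans (ler_norm _)).
Qed.

Lemma decr_env_ub f x y : Cb f -> x <= y -> f y <= decr_env f x.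
Proof.
move=> fC xy; apply: ub_le_sup; first exact: (decr_env_has_sup x fC).2.
by exists y.
Qed.

Lemma decr_env_le f x c : Cb f -> (forall y, x <= y -> f y <= c) ->
  decr_env f x <= c.
Proof.
move=> fC fc; apply: ge_sup; first exact: (decr_env_has_sup x fC).1.
by move=> _ [y /= xy <-]; exact: fc.
Qed.

Lemma decr_env_nonincreasing f : Cb f -> nonincreasing_fun (decr_env f).
Proof.
move=> fC x y xy; apply: decr_env_le => // z yz.
by apply: decr_env_ub => //; exact: le_trans yz.
Qed.

(** On a ball where [f] stays within [e / 2] of [f x], enlarging [[v, +oo)] to [[u, +oo)] adds only
    points of the ball, so the supremum grows by at most [e]. *)
Lemma decr_env_continuous f : Cb f -> continuous (decr_env f).
Proof.
move=> fC x; apply/cvgrPdist_le => e e0.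
have /cvgrPdist_le/(_ (e / 2))/(_ (divr_gt0 e0 (ltr0n R 2))) := fC.1 x.
move=> /nbhs_ballP[d /= d0 fd].
have osc u v : `|x - u| < d -> `|x - v| < d -> u <= v ->
    decr_env f v <= decr_env f u <= decr_env f v + e.
  move=> xu xv uv; rewrite decr_env_nonincreasing//=; apply: decr_env_le => // y uy.
  have [vy|/ltW yv] := leP v y.
    by rewrite (le_trans (decr_env_ub fC vy))// lerDl ltW.
  have xy : `|x - y| < d.
    by move: xu xv; rewrite !ltr_norml => /andP[? ?] /andP[? ?]; apply/andP; lra.
  have := fd _ xy; have := fd _ xv; have := decr_env_ub fC (lexx v).
  by rewrite /= !ler_norml => ? /andP[? ?] /andP[? ?]; lra.
apply/nbhs_ballP; exists d => //= y xy.
have xx : `|x - x| < d by rewrite subrr normr0.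
have [le_xy|/ltW le_yx] := leP x y.
  by have /andP[? ?] := osc _ _ xx xy le_xy; rewrite ler_norml; apply/andP; lra.
by have /andP[? ?] := osc _ _ xy xx le_yx; rewrite ler_norml; apply/andP; lra.
Qed.

Lemma decr_env_Cb_decr f : Cb f -> Cb_decr (decr_env f).
Proof.
move=> fC; split; last exact: decr_env_nonincreasing.
have [M fM] := Cb_bound fC.
apply: (@bound_Cb _ M); first exact: decr_env_continuous.
move=> x; rewrite ler_norml; apply/andP; split.
  apply: le_trans (decr_env_ub fC (lexx x)).
  by have := fM x; rewrite ler_norml => /andP[].
by apply: decr_env_le => // y _; rewrite (le_trans (ler_norm _)).
Qed.

Section env_shift.
Variables (f : R -> R) (h : R).
Hypotheses (fC : Cb f) (h0 : 0 < h).

Let S x := [set y | x <= y /\ decr_env f x - h <= f y].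

Let S_inf x : has_inf (S x).
Proof.
have [_ [y /= xy <-] fy] := sup_adherent h0 (decr_env_has_sup x fC).
by split; [exists y; split=> //; exact: ltW | exists x => z []].
Qed.

Let env_shift_in x : S x (env_shift f h x).
Proof.
have clS : closed (S x).
  rewrite [S x](_ : _ = [set y | x <= y] `&`
    f @^-1` [set z | decr_env f x - h <= z]) //.
  apply: closedI; first exact: closed_ge.
  by apply: closed_comp => [y _|]; [exact: fC.1 | exact: closed_ge].
apply: itv_closed_infimums (S_inf x).1 clS _ _; split.
  exact: ge_inf (S_inf x).2.
by move=> y; exact: lb_le_inf (S_inf x).1.
Qed.

Lemma env_shift_ge x : x <= env_shift f h x.
Proof. by have [] := env_shift_in x. Qed.

Lemma env_shift_near x : decr_env f x - h <= f (env_shift f h x).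
Proof. by have [] := env_shift_in x. Qed.

Lemma env_shift_nondecreasing : nondecreasing_fun (env_shift f h).
Proof.
move=> x y xy; have [Tyx|yTx] := leP (env_shift f h x) y.
  exact: le_trans (env_shift_ge y).
apply: ge_inf; first exact: (S_inf x).2.
split; first exact: le_trans (env_shift_ge y).
apply: le_trans (env_shift_near y); rewrite lerD2r.
(* Points of [[x, y)] lie before [env_shift f h x], so there [f] is below [decr_env f x - h]. As
   [h > 0], the supremum must come from [[y, +oo)], and the shift of [y] is a candidate for [x]. *)
have : decr_env f x <= Num.max (decr_env f x - h) (decr_env f y).
  apply: decr_env_le => // z xz; rewrite le_max.
  have [yz|zy] := leP y z; first by rewrite decr_env_ub ?orbT.
  rewrite leNgt; case: ltP => //= fz; have : env_shift f h x <= z.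
    by apply: ge_inf; [exact: (S_inf x).2 | split=> //; exact: ltW].
  by move=> /(lt_le_trans yTx); rewrite ltNge ltW.
by rewrite le_max => /orP[|//]; rewrite lerBrDl gerDr leNgt h0.
Qed.

End env_shift.

Lemma env_shift_measurable f h : Cb f -> 0 < h ->
  measurable_fun [set: measurableTypeR R]
    (env_shift f h : measurableTypeR R -> measurableTypeR R).
Proof.
move=> fC h0.
exact: nondecreasing_measurable (env_shift_nondecreasing fC h0).
Qed.

(** [Q'] is the image of [Q] under the shift [T]: [T x >= x] gives the stochastic order, and
    [decr_env f x - h <= f (T x)] is integrated against [Q]. *)
Lemma upper_Rintegral_decr_env Q f h : Cb f -> 0 < h ->
  exists2 Q' : borelP R, fosd Q Q' &
    \int[Q]_x decr_env f x <= \int[Q']_x f x + h.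
Proof.
move=> fC h0; pose T : measurableTypeR R -> measurableTypeR R := env_shift f h.
have mT : measurable_fun setT T := env_shift_measurable fC h0.
pose TX : {mfun measurableTypeR R >-> measurableTypeR R} :=
  MeasurableFun.Pack (MeasurableFun.Class (isMeasurableFun.Build _ _ _ _ _ mT)).
exists (distribution Q TX).
  move=> x; rewrite /distrib_fun /distribution /pushforward.
  apply: (@le_measure _ _ _ Q); rewrite ?inE.
  - by rewrite -[X in measurable X]setTI; exact: (mT measurableT).
  - exact: measurable_itv.
  - by move=> y /=; rewrite !in_itv/=; exact: le_trans (env_shift_ge fC h0 y).
have [M fM] := Cb_bound fC.
have mfT : measurable_fun setT (f \o T).
  by apply: measurableT_comp => //; exact: Cb_measurable.
have ifT : Q.-integrable setT (EFin \o (f \o T)).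
  exact: bounded_integrable mfT (fun x => fM (T x)).
have /measurable_EFinP mf := Cb_measurable fC.
have -> : \int[distribution Q TX]_x f x = \int[Q]_x f (T x).
  by congr fine; exact: (integral_distribution (X := TX) mf ifT).
have ih := Cb_integrable Q (Cb_cst h).
rewrite -[h in leRHS](probability_Rintegral_cst Q) -RintegralD//.
apply: le_Rintegral => //.
- exact: Cb_integrable (decr_env_Cb_decr fC).1.
- exact: (integrableD measurableT ifT ih).
- by move=> x _; rewrite -lerBlDr; exact: env_shift_near.
Qed.

End Cb_theory.

(** * From separation to the dual representations *)

Lemma lee_from_below {R : realType} (x y : \bar R) :
  (forall a : R, (a%:E < x)%E -> (a%:E <= y)%E) -> (x <= y)%E.
Proof.
move=> xy; rewrite leNgt; apply/negP.
case: y xy => [y||] xy; last first.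
- case: x xy => [x||] xy // _.
    by have := xy (x - 1); rewrite lte_fin ltrBlDr ltrDl leeNy_eq => /(_ ltr01).
  by have := xy 0 (ltry _); rewrite leeNy_eq.
- by rewrite ltNge leey.
- case: x xy => [x||] xy //.
    rewrite lte_fin => yx; have := xy ((y + x) / 2).
    by rewrite lte_fin lee_fin midf_lt// leNgt midf_lt// => /(_ isT).
  move=> _; have := xy (y + 1) (ltry _).
  by rewrite lee_fin gerDl ler10.
Qed.

Section risk_measure_theory.
Context {R : realType} (Phi : borelP R -> \bar R).
Implicit Types (P Q : borelP R) (f : R -> R).
Hypotheses (riskPhi : risk_measure Phi) (lscPhi : lower_semicontinuous Phi).

Lemma sublevel_separation P (a : R) : (a%:E < Phi P)%E ->
  exists2 f, Cb_decr f & exists2 d : R, 0 < d &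
    forall Q, (Phi Q <= a%:E)%E -> \int[Q]_x f x + d <= \int[P]_x f x.
Proof.
move=> /lscPhi[V PV Va].
pose A : set (borelP R) := [set Q | (Phi Q <= a%:E)%E].
have cvxA (r : {i01 R}) Q Q' : A Q -> A Q' -> A (mixture r Q Q').
  move=> AQ AQ'; apply: le_trans (risk_quasiconvex riskPhi r Q Q') _.
  by rewrite ge_max; apply/andP.
have VA0 : V `&` A = set0.
  by apply/seteqP; split=> // Q [/Va + AQ]; rewrite ltNge AQ.
have [f fC [d d0 sepA]] := convex_separation cvxA PV VA0.
exists (decr_env f); first exact: decr_env_Cb_decr.
(* The other half of the gap pays for the approximation error [h = d / 2] of the envelope. *)
exists (d / 2); first by rewrite divr_gt0.
move=> Q AQ.
have [Q' QQ' leQ'] := upper_Rintegral_decr_env Q fC (divr_gt0 d0 (ltr0n R 2)).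
(* By monotonicity the shifted measure [Q'] stays in the sublevel set. *)
have := sepA _ (le_trans (risk_monotone riskPhi QQ') AQ).
have : \int[P]_x f x <= \int[P]_x decr_env f x.
  apply: le_Rintegral => //; [exact: Cb_integrable| |].
    exact: Cb_integrable (decr_env_Cb_decr fC).1.
  by move=> x _; exact: decr_env_ub.
move: leQ'; move: (\int[P]_x f x) (\int[P]_x _) (\int[Q]_x _) (\int[Q']_x _).
clear => u v w z; lra.
Qed.

Lemma dualR_nondecreasing f s t : s <= t -> (dualR Phi s f <= dualR Phi t f)%E.
Proof.
move=> st; apply: ereal_inf_le_tmp => _ [Q /= tQ <-]; exists Q => //=.
exact: le_trans tQ.
Qed.

Lemma dualR_left_le f t : (dualR_left Phi t f <= dualR Phi t f)%E.
Proof.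
apply: ge_ereal_sup => _ [s /= st <-]; apply: dualR_nondecreasing.
exact: ltW.
Qed.

Lemma dualR_le P f : (dualR Phi (\int[P]_x f x) f <= Phi P)%E.
Proof. by apply: ereal_inf_lbound; exists P => /=. Qed.

Lemma le_sup_dualR_left P : (Phi P <= ereal_sup
  [set dualR_left Phi (\int[P]_x f x) f | f in @Cb_decr R])%E.
Proof.
apply: lee_from_below => a aP; have [f fC [d d0 sepf]] := sublevel_separation aP.
apply: le_ereal_sup_tmp; eexists; first by exists f.
apply: le_ereal_sup_tmp; eexists.
  (* This level is below the integral against [P] but above all integrals over [Phi <= a], so every
     measure reaching it has [Phi > a]. *)
  by exists (\int[P]_x f x - d / 2) => //=; rewrite ltrBlDr ltrDl divr_gt0.
apply: le_ereal_inf_tmp => _ [Q /= fQ <-]; rewrite leNgt.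
apply/negP => /ltW/sepf; move: fQ.
by move: (\int[Q]_x _) (\int[P]_x _) d0; clear => u v; lra.
Qed.

Lemma dualR_left_support_level t f :
  dualR_left Phi t f = ereal_inf [set m%:E | m in
    [set m : R | (t%:E <= support_level Phi m f)%E]].
Proof.
apply/eqP; rewrite eq_le; apply/andP; split.
  apply: ge_ereal_sup => _ [s /= st <-]; apply: le_ereal_inf_tmp => _ [m /= tm <-].
  (* The supremum need not be attained; [s < t] leaves room to pick an actual [Q]. *)
  have /ereal_sup_gt[_ [Q Qm <-]] : (s%:E < support_level Phi m f)%E.
    by apply: lt_le_trans tm; rewrite lte_fin.
  rewrite lte_fin => sQ; apply: ge_ereal_inf; exists (Phi Q) => //.
  by exists Q => //; exact: ltW.
(* By contraposition: for [a] above [dualR_left], each [s < t] is reached by some [Q] with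
   [Phi Q < a], so [a] is an admissible [m]. *)
apply: lee_from_below => a; apply: contraTT; rewrite -ltNge -leNgt => Ra.
apply: ge_ereal_inf; exists a%:E => //; exists a => //=.
apply: lee_from_below => s; rewrite lte_fin => st.
have /ereal_inf_lt[_ [Q /= sQ <-] Qa] : (dualR Phi s f < a%:E)%E.
  by apply: le_lt_trans Ra; apply: ereal_sup_ubound; exists s.
apply: le_ereal_sup_tmp; exists (\int[Q]_x f x)%:E; last by rewrite lee_fin.
by exists Q => //; exact: ltW.
Qed.

End risk_measure_theory.

Theorem proposition26 (R : realType) (Phi : borelP R -> \bar R)
    (riskPhi : risk_measure Phi) (lscPhi : lower_semicontinuous Phi) :
  [/\ forall P : borelP R,
        Phi P = ereal_sup
          [set dualR Phi (\int[P]_x f x) f | f in @Cb_decr R],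
      forall P : borelP R,
        Phi P = ereal_sup
          [set dualR_left Phi (\int[P]_x f x) f | f in @Cb_decr R] &
      forall (t : R) (f : R -> R), Cb f ->
        dualR_left Phi t f =
        ereal_inf [set m%:E | m in
          [set m : R | (t%:E <= support_level Phi m f)%E]]].
Proof.
have le_sup := le_sup_dualR_left riskPhi lscPhi.
split=> [P|P|t f _]; last exact: dualR_left_support_level.
- apply/eqP; rewrite eq_le; apply/andP; split; last first.
    by apply: ge_ereal_sup => _ [f _ <-]; exact: dualR_le.
  (* Since [dualR_left <= dualR], the lower bound proved for [dualR_left] carries over. *)
  apply: le_trans (le_sup P) _; apply: ge_ereal_sup => _ [f fC <-].
  by apply: le_ereal_sup_tmp; eexists; [exists f | exact: dualR_left_le].
- apply/eqP; rewrite eq_le le_sup/=; apply: ge_ereal_sup => _ [f _ <-].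
  exact: le_trans (dualR_left_le _ _ _) (dualR_le _ _ _).
Qed.
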